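(* Let $m\ge 2$ be an integer. Let $\mathcal A^*_m$ be the component of the digraph $\mathcal D^*_m$ containing the vertex $1^m=11\cdots1$ and let $\mathcal R^*_m$ be the component of $\mathcal D^*_m$ containing the vertex $0^m=00\cdots0$. Then $\mathcal A^*_m=\mathcal R^*_m$ if and only if $m$ is even.
   Context: Components are weakly connected components. The vertex $1^m$ is the unique vertex of $\mathcal D^*_m$ with a loop. Digraph $\mathcal D_m$: let $\mathcal D_{ud}$ be the digraph on $\{a,b,c,d,e,f\}$ with arcs from each of $a,b,d$ to each of $b,c,f$, and from each of $c,e,f$ to each of $a,d,e$; let $\mathcal D_{lr}$ be the digraph on the same letters with arcs from each of $a,c,e$ to each of $d,e,f$, and from each of $b,d,f$ to each of $a,b,c$. $V(\mathcal D_m)$ is the set of words $\alpha_1\cdots\alpha_m$ over $\{a,b,c,d,e,f\}$ with $\alpha_1\in\{a,d,e\}$, $\alpha_m\in\{c,e,f\}$ and each $(\alpha_i,\alpha_{i+1})$, $1\le i\le m-1$, an arc of $\mathcal D_{ud}$. There is an arc $\alpha_1\cdots\alpha_m\to\beta_1\cdots\beta_m$ in $\mathcal D_m$ iff every $(\alpha_i,\beta_i)$ is an arc of $\mathcal D_{lr}$. Digraph $\mathcal D^*_m$: the outlet word of $\alpha=\alpha_1\cdots\alpha_m\in V(\mathcal D_m)$ is the binary word $o(\alpha)=o_1\cdots o_m$ with $o_j=0$ if $\alpha_j\in\{b,d,f\}$ and $o_j=1$ if $\alpha_j\in\{a,c,e\}$. Then $V(\mathcal D^*_m)=\{o(\alpha):\alpha\in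 V(\mathcal D_m)\}$, and there is a (single) arc $v\to w$ in $\mathcal D^*_m$ iff there are $x,y\in V(\mathcal D_m)$ with $x\to y$ in $\mathcal D_m$, $o(x)=v$, $o(y)=w$ (loops allowed). *)

(* Defs.v *)
From HB Require Import structures.
From mathcomp Require Import all_boot.

Set Implicit Arguments.
Unset Strict Implicit.
Unset Printing Implicit Defensive.

(* A digraph carried by a finite type: loops allowed, no multiple arcs. *)
Record digraph (T : finType) := Digraph {
  vertices : {set T};
  arcs : {set T * T}
}.

Definition adjacent (T : finType) (G : digraph T) : rel T :=
  [rel x y | ((x, y) \in arcs G) || ((y, x) \in arcs G)].

(* The weakly connected component of v, as an induced subdigraph. *)
Definition component (T : finType) (G : digraph T) (v : T) : digraph T :=
  let C := [set w in vertices G | connect (adjacent G) v w] in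
  Digraph C [set p in arcs G | (p.1 \in C) && (p.2 \in C)].

Inductive letter := La | Lb | Lc | Ld | Le | Lf.

Definition nat_of_letter (x : letter) : nat :=
  match x with La => 0 | Lb => 1 | Lc => 2 | Ld => 3 | Le => 4 | Lf => 5 end.

Definition letter_of_nat (n : nat) : option letter :=
  match n with
  | 0 => Some La | 1 => Some Lb | 2 => Some Lc
  | 3 => Some Ld | 4 => Some Le | 5 => Some Lf | _ => None
  end.

Lemma nat_of_letterK : pcancel nat_of_letter letter_of_nat.
Proof. by case. Qed.

HB.instance Definition _ := Countable.copy letter (pcan_type nat_of_letterK).

Lemma letter_enumP : Finite.axiom [:: La; Lb; Lc; Ld; Le; Lf].
Proof. by case. Qed.

HB.instance Definition _ := isFinite.Build letter letter_enumP.

Definition D_ud : rel letter := [rel x y |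
     (x \in [:: La; Lb; Ld]) && (y \in [:: Lb; Lc; Lf])
  || (x \in [:: Lc; Le; Lf]) && (y \in [:: La; Ld; Le])].

Definition D_lr : rel letter := [rel x y |
     (x \in [:: La; Lc; Le]) && (y \in [:: Ld; Le; Lf])
  || (x \in [:: Lb; Ld; Lf]) && (y \in [:: La; Lb; Lc])].

Definition admissible (s : seq letter) : bool :=
  if s is x :: s' then
    [&& x \in [:: La; Ld; Le], last x s' \in [:: Lc; Le; Lf] & path D_ud x s']
  else false.

Definition D (m : nat) : digraph (m.-tuple letter) :=
  let V := [set w : m.-tuple letter | admissible w] in
  Digraph V
    [set p | [&& p.1 \in V, p.2 \in V &
               [forall i : 'I_m, D_lr (tnth p.1 i) (tnth p.2 i)]]].

(* Binary words are boolean tuples, with true for 1 and false for 0. *)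
Definition outlet (m : nat) (w : m.-tuple letter) : m.-tuple bool :=
  [tuple of [seq x \in [:: La; Lc; Le] | x <- w]].

Definition Dstar (m : nat) : digraph (m.-tuple bool) :=
  Digraph [set outlet w | w in vertices (D m)]
          [set (outlet p.1, outlet p.2) | p in arcs (D m)].

Definition ones (m : nat) : m.-tuple bool := [tuple of nseq m true].
Definition zeros (m : nat) : m.-tuple bool := [tuple of nseq m false].

Lemma ones_in_Dstar (m : nat) : 2 <= m -> ones m \in vertices (Dstar m).
Proof.
case: m => [|m] // _; apply/imsetP; exists [tuple of nseq m.+1 Le].
  have last_Le : last Le (nseq m Le) = Le by elim: m.
  by rewrite inE /= last_Le /=; elim: m {last_Le}.
by apply/val_inj; rewrite /= map_nseq.
Qed.

Lemma zeros_in_Dstar (m : nat) : 2 <= m -> zeros m \in vertices (Dstar m).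
Proof.
case: m => [|[|m]] // _.
apply/imsetP; exists [tuple of Ld :: rcons (nseq m Lb) Lf].
  rewrite inE /= last_rcons rcons_path /=.
  by case: m => // m; elim: m.
apply/val_inj; rewrite /= map_rcons map_nseq /=; congr (_ :: _).
by elim: m => //= m <-.
Qed.

(* Main.v *)
Require Import Defs.
From mathcomp Require Import all_boot.

(** A letter records which two of its four incident grid edges (up, down, left,
    right) a vertex of a 2-factor uses: a is down-right, b is up-down, c is
    up-right, d is down-left, e is left-right and f is up-left. A word of
    [D m] is then one column of height m, its outlet word lists the edges
    leaving it to the right, and an arc glues two consecutive columns.

    Every vertex has degree 2, so in one column the number of left edges plus
    the number of right edges is even: each vertical edge is counted at both of
    its ends ([odd_right_left]). The left edges of a column are the right edges
    of its predecessor, hence the parity of the number of 1s is the same at both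
    ends of an arc of [Dstar m], and so is constant on components
    ([odd_ones_adjacent]). For odd m it separates 1^m from 0^m.

    For even m the column dfdf...df is made of vertical edges that match the
    rows 1-2, 3-4, and so on; it absorbs a left edge in each row and emits no
    right edge, so it gives an arc from 1^m to 0^m ([ones_zeros_arc]). *)

Set Implicit Arguments.
Unset Strict Implicit.
Unset Printing Implicit Defensive.

Definition has_up (x : letter) : bool := x \in [:: Lb; Lc; Lf].
Definition has_down (x : letter) : bool := x \in [:: La; Lb; Ld].
Definition has_left (x : letter) : bool := x \in [:: Ld; Le; Lf].
Definition has_right (x : letter) : bool := x \in [:: La; Lc; Le].

Lemma D_udE x y : D_ud x y = (has_down x == has_up y).
Proof. by case: x; case: y. Qed.

Lemma D_lrE x y : D_lr x y = (has_right x == has_left y).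
Proof. by case: x; case: y. Qed.

Lemma addb_degree x :
  has_right x (+) has_left x = has_up x (+) has_down x.
Proof. by case: x. Qed.

(** Modulo 2 the horizontal degree of a vertex equals its vertical degree, and
    the vertical degrees telescope along the column. *)
Lemma odd_right_left x s : path D_ud x s ->
  odd (count has_right (x :: s)) (+) odd (count has_left (x :: s))
  = has_up x (+) has_down (last x s).
Proof.
elim: s x => [|y s IHs] x; first by rewrite /= !addn0 !oddb addb_degree.
rewrite [path _ _ _]/= [last _ _]/= D_udE => /andP[/eqP down_x /IHs IHy].
have oddS p : odd (count p [:: x, y & s]) = p x (+) odd (count p (y :: s)).
  by rewrite -[in RHS](oddb (p x)) -oddD.
by rewrite !oddS addbACA IHy addb_degree down_x addbA addbK.
Qed.

Lemma odd_right_left_admissible s : admissible s ->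
  odd (count has_right s) = odd (count has_left s).
Proof.
case: s => // x s /and3P[no_up no_down /odd_right_left].
have -> : has_up x = false by case: (x) no_up.
have -> : has_down (last x s) = false by case: (last x s) no_down.
by move/eqP; rewrite addbF eqbF_neg negb_add => /eqP.
Qed.

(** The left edges of the second column are the right edges of the first, so
    the degree count in the second column compares the two outlet words. *)
Lemma odd_ones_arc m (p : m.-tuple letter * m.-tuple letter) :
  p \in arcs (D m) ->
  odd (count id (outlet p.1)) = odd (count id (outlet p.2)).
Proof.
rewrite inE => /and3P[_]; rewrite inE => adm_y /forallP arc_xy.
have -> : outlet p.1 = [tuple of [seq has_left y | y <- p.2]].
  apply: eq_from_tnth => i; rewrite !tnth_map.
  by have := arc_xy i; rewrite D_lrE => /eqP.
by rewrite !count_map -(odd_right_left_admissible adm_y).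
Qed.

Lemma odd_ones_adjacent m :
  closed (adjacent (Dstar m)) [pred w : m.-tuple bool | odd (count id w)].
Proof.
by move=> v w /orP[] /imsetP[p /odd_ones_arc odd_p [-> ->]]; rewrite !inE.
Qed.

Lemma adjacent_sym (T : finType) (G : digraph T) : symmetric (adjacent G).
Proof. by move=> x y; apply: orbC. Qed.

Lemma component_connect (T : finType) (G : digraph T) (v w : T) :
  connect (adjacent G) v w -> component G v = component G w.
Proof.
move=> conn_vw; rewrite /component.
suff -> : [set u in vertices G | connect (adjacent G) v u]
        = [set u in vertices G | connect (adjacent G) w u] by [].
apply/setP => u; rewrite !inE.
by rewrite (same_connect (sym_connect_sym (adjacent_sym G)) conn_vw).
Qed.

(** As a column, the perfect matching of the rows 1-2, 3-4, ... by vertical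
    edges, each end of which also has a left edge. *)
Definition matched_rows (k : nat) : seq letter := flatten (nseq k [:: Ld; Lf]).

Lemma size_matched_rows k : size (matched_rows k) = k.*2.
Proof. by elim: k => //= k ->. Qed.

Lemma admissible_matched_rows k : admissible (matched_rows k.+1).
Proof. by apply/and3P; split=> //; elim: k. Qed.

Lemma matched_rows_letters k : all (mem [:: Ld; Lf]) (matched_rows k).
Proof. by elim: k. Qed.

Lemma admissible_nseq_e n : admissible (nseq n.+1 Le).
Proof. by apply/and3P; split=> //; elim: n. Qed.

(** The arc comes from the column e^m of horizontal edges followed by the
    column (df)^(m/2), which ends all of them. *)
Lemma ones_zeros_arc k : (ones k.+1.*2, zeros k.+1.*2) \in arcs (Dstar k.+1.*2).
Proof.
have szr : size (matched_rows k.+1) == k.+1.*2 by rewrite size_matched_rows.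
pose y := Tuple szr; pose x : k.+1.*2.-tuple letter := [tuple of nseq _ Le].
have y_df i : tnth y i \in [:: Ld; Lf].
  exact: (allP (matched_rows_letters k.+1)) (mem_tnth i y).
apply/imsetP; exists (x, y).
  rewrite inE; apply/and3P; split;
    rewrite ?inE ?admissible_matched_rows ?admissible_nseq_e //.
  apply/forallP => i; rewrite D_lrE tnth_nseq.
  by case: (tnth y i) (y_df i).
congr pair; apply: eq_from_tnth => i; rewrite tnth_map tnth_nseq.
  by rewrite tnth_nseq.
by case: (tnth y i) (y_df i).
Qed.

Theorem theorem3p17 (m : nat) (hm : 2 <= m) :
  component (Dstar m) (ones m) = component (Dstar m) (zeros m) <-> ~~ odd m.
Proof.
split=> [eq_comp | even_m].
  have : ones m \in vertices (component (Dstar m) (ones m)).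
    by rewrite inE ones_in_Dstar ?connect0.
  rewrite eq_comp inE => /andP[_ /(closed_connect (@odd_ones_adjacent m))].
  by rewrite !inE !count_nseq mul0n mul1n => <-.
apply/component_connect/connect1/orP; left.
have <- : (m./2.-1.+1).*2 = m by rewrite prednK ?half_gt0 // even_halfK.
exact: ones_zeros_arc.
Qed.
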